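(* Let $H$ be a Hilbert space, let $\Omega=\{-1,1\}^{\infty}$ be the Cantor group and let $\mu$ be its Haar measure. The function $$\varphi(\omega)=\sum_{j=1}^\infty\omega_j\mathbf{x}_j,\qquad \omega=(\omega_j)_{j\ge1}\in\Omega,$$ where $(\mathbf{x}_j)_{j\ge1}$ is a sequence of vectors in $H$, is a Hilbert point in $L^p(\Omega;H)$ for some $p\ne2$ (with $1\le p\le\infty$) if and only if one of the following holds: (a) $(\mathbf{x}_j)_{j\ge1}$ is an orthogonal sequence satisfying $\sum_{j\ge1}\|\mathbf{x}_j\|_H^2<\infty$; (b) $\mathbf{x}_1=\mathbf{x}_2$ for a nonzero vector $\mathbf{x}_1$, and $\mathbf{x}_j=\mathbf{0}$ for all $j\ge3$; (c) $\mathbf{u}$ and $\mathbf{v}$ are nonzero vectors satisfying $\|\mathbf{u}\|_H=\|\mathbf{v}\|_H$ and $\mathbf{u}\perp\mathbf{v}$, and $$\mathbf{x}_1=\mathbf{u},\qquad \mathbf{x}_2=\frac12\mathbf{u}+\frac{\sqrt3}{2}\mathbf{v},\qquad \mathbf{x}_3=\frac12\mathbf{u}-\frac{\sqrt3}{2}\mathbf{v},$$ and $\mathbf{x}_j=\mathbf{0}$ for all $j\ge4$.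
   Context: Under the Haar (probability) measure $\mu$, the coordinates $\omega_j$ are independent random variables taking the values $\pm1$ with equal probability. For $1\le p\le\infty$, $L^p(\Omega;H)$ is the usual $L^p$ space of $H$-valued Bochner integrable functions $f$ on $\Omega$, with norm $\|f\|_p=\big(\int_\Omega\|f(\omega)\|_H^p\,d\mu(\omega)\big)^{1/p}$ (the essential supremum of $\|f(\omega)\|_H$ if $p=\infty$). The inner product is that of $L^2(\Omega;H)$, namely $\langle f,g\rangle=\int_\Omega\langle f(\omega),g(\omega)\rangle_H\,d\mu(\omega)$. Definition (Hilbert point). A Hilbert point in $L^p(\Omega;H)$ is a nontrivial function $\varphi\in L^p(\Omega;H)$ (that is, not almost everywhere equal to $\mathbf{0}$) such that, for every $f\in L^p(\Omega;H)$, $\langle f,\varphi\rangle=0$ implies $\|\varphi\|_p\le\|\varphi+f\|_p$. When $p<2$, the condition $\langle f,\varphi\rangle=0$ is by convention declared to hold whenever $f$ lies in the closure in $L^p(\Omega;H)$ of the set of functions $g\in L^\infty(\Omega;H)$ satisfying $\langle g,\varphi\rangle=0$.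
   Formalization: H is taken to be a real Hilbert space; in (a) the vectors x_j are not all zero; (b) and (c) are understood up to a permutation of the x_j and sign changes x_j → −x_j. *)

(* Defs.v *)
(* MathComp / MathComp-Analysis *)
From HB Require Import structures.
From mathcomp Require Export all_boot all_order all_algebra.
From mathcomp Require Export all_classical all_reals all_analysis.

Set Implicit Arguments.
Unset Strict Implicit.
Unset Printing Implicit Defensive.
Import Order.TTheory GRing.Theory Num.Theory.
Import numFieldNormedType.Exports.

Local Open Scope classical_set_scope.
Local Open Scope ring_scope.

(* The Cantor group {-1,1}^oo is encoded as bool^nat with its Borel
   sigma-algebra: the boolean b stands for the sign (-1)^b, so that the group
   law is the coordinatewise exclusive or.  Coordinates are numbered from 0. *)
Definition cantor_group := g_sigma_algebraType (@open cantor_space).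

Definition cantor_mul (a w : cantor_group) : cantor_group :=
  fun j => a j (+) w j.

Definition coord_sign (R : realType) (j : nat) (w : cantor_group) : R :=
  (-1) ^+ w j.

(* Regularity is automatic, every open subset of bool^nat being
   sigma-compact. *)
Definition is_haar (R : realType) (mu : probability cantor_group R) : Prop :=
  forall (a : cantor_group) (A : set cantor_group),
    measurable A -> mu (cantor_mul a @` A) = mu A.

Section hilbert_valued_Lp.
Context (R : realType) (H : completeNormedModType R) (dot : {dot H for idfun}).
Context d (T : measurableType d) (mu : probability T R).
Implicit Types (f g phi : T -> H) (p : \bar R).

Definition simple_fun f : Prop :=
  finite_set (range f) /\ forall y, measurable (f @^-1` [set y]).

(* The limit is taken at every point: an almost everywhere limit of simple
   functions agrees almost everywhere with such a function, so each class of
   L^p has a representative of this kind. *)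
Definition strongly_measurable f : Prop :=
  exists s : nat -> T -> H, (forall n, simple_fun (s n)) /\
    forall w, s n w @[n --> \oo] --> f w.

Definition norm_Lp p f : \bar R := Lnorm mu p (fun w => `|f w|%:E).

(* As mu is finite and p >= 1 in all uses, finiteness of the norm entails
   Bochner integrability. *)
Definition in_Lp p f : Prop := strongly_measurable f /\ (norm_Lp p f < +oo)%E.

Definition inner_Lp f g : \bar R := (\int[mu]_w (dot (f w) (g w))%:E)%E.

(* For p < 2 the pairing of f and phi in L^p need not be integrable, and
   orthogonality means membership in the L^p-closure of the bounded functions
   orthogonal to phi. *)
Definition orthogonal_Lp p f phi : Prop :=
  if (p < 2%:E)%E then
    forall e : R, 0 < e -> exists g, [/\ in_Lp +oo%E g,
      inner_Lp g phi = 0%E & (norm_Lp p (fun w => (f w - g w)%R) < e%:E)%E]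
  else inner_Lp f phi = 0%E.

Definition hilbert_point p phi : Prop :=
  [/\ in_Lp p phi,
      ~ {ae mu, forall w, phi w = 0} &
      forall f, in_Lp p f -> orthogonal_Lp p f phi ->
        (norm_Lp p phi <= norm_Lp p (fun w => (phi w + f w)%R))%E].

End hilbert_valued_Lp.

Section rademacher.
Context (R : realType) (H : completeNormedModType R).

Definition rademacher_series (x : nat -> H) (w : cantor_group) : nat -> H :=
  series (fun j => coord_sign R j w *: x j).

Definition rademacher_sum (x : nat -> H) (w : cantor_group) : H :=
  limn (rademacher_series x w).

(* These rearrangements are induced by the symmetries of the Cantor group that
   permute the coordinates and flip their signs; they preserve Haar measure. *)
Definition signed_permutation (x y : nat -> H) : Prop :=
  exists (s : nat -> nat) (e : nat -> bool),
    bijective s /\ forall j, y j = (-1) ^+ e j *: x (s j).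

End rademacher.

(* Main.v *)
Require Import Defs.
From mathcomp Require Import all_boot all_order all_algebra.
From mathcomp Require Import all_classical all_reals all_analysis.
From mathcomp Require Import measurable_realfun ess_sup_inf ring lra.
Import Order.TTheory GRing.Theory Num.Theory.
Import numFieldNormedType.Exports.
Local Open Scope classical_set_scope.
Local Open Scope ring_scope.
Set Implicit Arguments.
Unset Strict Implicit.
Unset Printing Implicit Defensive.

(* A function phi is a Hilbert point in L^p, p <> 2, exactly when |phi| takes
   almost surely only the value 0 and one other value.  If |phi| took values
   both in ]0, a] and in [b, +oo[ with a < b, then enlarging phi slightly on one
   level set and shrinking it on the other, in a proportion that keeps the
   perturbation orthogonal to phi, would decrease the L^p norm: to first order
   the change compares the integrals of |phi|^p and |phi|^2 over the two sets.
   Conversely, a two-valued phi is a Hilbert point in L^oo by Cauchy-Schwarz.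

   For a Rademacher sum the property |phi| in {0, c} holds, for almost every w,
   at all sign sequences obtained from w by finitely many flips; no independence
   is needed beyond this.  Write y_j = w_j x_j.  If phi vanishes at such a w,
   flipping one or two coordinates gives |2 y_i|, |2 (y_i + y_j)| in {0, c}, so
   the nonzero y_i have equal length and pairwise angles of at least 120
   degrees; there are at most three of them and their sum is 0, which gives (b)
   and (c).  Otherwise |phi| = c at all these points, and comparing flips of one
   and of two coordinates shows that the x_j are orthogonal; Bessel's inequality
   then bounds the sum of their squared lengths. *)

(** * Geometry of a real inner product space *)

Section real_inner_product.
Context (R : realType) (H : completeNormedModType R) (dot : {dot H for idfun}).
Hypothesis dotE : forall u : H, dot u u = `|u| ^+ 2.
Implicit Types (u v w : H) (a : R).

Lemma dotC u v : dot u v = dot v u.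
Proof. by rewrite hermitian_subproof expr0 mul1r. Qed.

Lemma dotDl u v w : dot (u + v) w = dot u w + dot v w.
Proof. exact: linearDl. Qed.

Lemma dotDr u v w : dot w (u + v) = dot w u + dot w v.
Proof. exact: linearDr. Qed.

Lemma dotZl a u v : dot (a *: u) v = a * dot u v.
Proof. by rewrite linearZl_LR. Qed.

Lemma dotZr a u v : dot u (a *: v) = a * dot u v.
Proof. by rewrite dotC dotZl dotC. Qed.

Lemma dotNl u v : dot (- u) v = - dot u v.
Proof. by rewrite -scaleN1r dotZl mulN1r. Qed.

Lemma dotNr u v : dot u (- v) = - dot u v.
Proof. by rewrite dotC dotNl dotC. Qed.

Lemma dot_suml I (s : seq I) (F : I -> H) v :
  dot (\sum_(i <- s) F i) v = \sum_(i <- s) dot (F i) v.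
Proof.
elim: s => [|i s IH]; first by rewrite !big_nil linear0l.
by rewrite !big_cons dotDl IH.
Qed.

Lemma dot_sumr I (s : seq I) (F : I -> H) v :
  dot v (\sum_(i <- s) F i) = \sum_(i <- s) dot v (F i).
Proof. by rewrite dotC dot_suml; apply: eq_bigr => i _; exact: dotC. Qed.

(** The squared norm of [|v| u - |u| v] is nonnegative and equals [2 |u| |v|] times the difference
    of the two sides. *)
Lemma dot_cauchy_schwarz u v : dot u v <= `|u| * `|v|.
Proof.
have [->|u0] := eqVneq u 0; first by rewrite linear0l normr0 mul0r.
have [->|v0] := eqVneq v 0; first by rewrite linear0r normr0 mulr0.
have nu : 0 < `|u| by rewrite normr_gt0.
have nv : 0 < `|v| by rewrite normr_gt0.
have := sqr_ge0 `| `|v| *: u - `|u| *: v|.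
rewrite -dotE !(dotDl, dotDr, dotNl, dotNr, dotZl, dotZr) !dotE (dotC v u).
rewrite (_ : _ + _ = 2 * (`|u| * `|v|) * (`|u| * `|v| - dot u v)); last by ring.
by rewrite pmulr_rge0 ?subr_ge0// !mulr_gt0.
Qed.

Lemma normB2 u v : `|u - v| ^+ 2 = `|u| ^+ 2 - 2 * dot u v + `|v| ^+ 2.
Proof. by rewrite -!dotE !(dotDl, dotDr, dotNl, dotNr) (dotC v u); ring. Qed.

Lemma normD2 u v : `|u + v| ^+ 2 = `|u| ^+ 2 + 2 * dot u v + `|v| ^+ 2.
Proof. by rewrite -!dotE !(dotDl, dotDr) (dotC v u); ring. Qed.

Lemma normD2_orthogonal u v : dot u v = 0 ->
  `|u + v| ^+ 2 = `|u| ^+ 2 + `|v| ^+ 2.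
Proof. by rewrite normD2 => ->; rewrite mulr0 addr0. Qed.

Lemma norm2Z a u : `|a *: u| ^+ 2 = a ^+ 2 * `|u| ^+ 2.
Proof. by rewrite normrZ exprMn real_normK ?num_real. Qed.

Lemma norm_sum_orthogonal (I : eqType) (s : seq I) (y : I -> H) : uniq s ->
  (forall i j, i != j -> dot (y i) (y j) = 0) ->
  `|\sum_(i <- s) y i| ^+ 2 = \sum_(i <- s) `|y i| ^+ 2.
Proof.
move=> us yo; elim: s us => [_|i s IH /= /andP[nis us]].
  by rewrite !big_nil normr0 expr0n.
rewrite !big_cons normD2_orthogonal ?IH// dot_sumr.
rewrite big_seq big1// => j js; apply: yo.
by apply: contraNneq nis => ->.
Qed.

(** Here [v] stands for the value of the sum at a point and [y] for its signed terms, so that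
    subtracting [2 y i] is the effect of flipping coordinate i. *)
Section equal_norms.
Variables (y : nat -> H) (v : H).
Hypothesis flip1 : forall i, `|v - 2 *: y i| = `|v|.
Hypothesis flip2 : forall i j, i != j -> `|v - 2 *: y i - 2 *: y j| = `|v|.

Let dot_flip i : dot v (y i) = `|y i| ^+ 2.
Proof.
have := congr1 (fun r => r ^+ 2) (flip1 i).
by rewrite normB2 dotZr norm2Z; lra.
Qed.

(** A single flip preserves the norm, which forces [dot v (y i)] to be the squared norm of [y i]. In
    the expansion of the double flip everything then cancels except [8 dot (y i) (y j)]. *)
Lemma equal_norm_orthogonal i j : i != j -> dot (y i) (y j) = 0.
Proof.
move=> ij; have := congr1 (fun r => r ^+ 2) (flip2 ij).
rewrite normB2 flip1 norm2Z dotDl dotNl dotZl !dotZr dot_flip; lra.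
Qed.

(** Bessel's inequality: the cross term in the squared distance from [v] to the partial sum is twice
    the sum of the squared norms. *)
Lemma equal_norm_bessel n : \sum_(0 <= i < n) `|y i| ^+ 2 <= `|v| ^+ 2.
Proof.
have := sqr_ge0 `|v - \sum_(0 <= i < n) y i|.
rewrite normB2 norm_sum_orthogonal ?iota_uniq//; last exact: equal_norm_orthogonal.
rewrite dot_sumr (eq_bigr _ (fun i _ => dot_flip i)); lra.
Qed.

End equal_norms.

(** Two vectors as long as their sum form an angle of 120 degrees. Hence [y1 - y2] has length
    [sqrt 3] times that of [y0], and it is orthogonal to [y1 + y2] because [y1] and [y2] have the
    same length. *)
Lemma hexagonal_triple (y0 y1 y2 : H) : y0 = y1 + y2 -> y0 != 0 ->
  `|y1| = `|y0| -> `|y2| = `|y0| ->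
  exists u v : H, [/\ [/\ u <> 0, v <> 0, `|u| = `|v| & dot u v = 0],
    y0 = u, y1 = 2^-1 *: u + (Num.sqrt 3 / 2) *: v &
    y2 = 2^-1 *: u - (Num.sqrt 3 / 2) *: v].
Proof.
move=> y0E y0n0 n1 n2.
have s3 : (Num.sqrt 3 : R) != 0 by rewrite sqrtr_eq0 -ltNge.
have d12 : 2 * dot y1 y2 = - `|y0| ^+ 2.
  by have := normD2 y1 y2; rewrite -y0E n1 n2; lra.
have vE : `|y0| = `|(Num.sqrt 3)^-1 *: (y1 - y2)|.
  apply/eqP; rewrite -(@eqrXn2 _ 2%N `|y0|)// norm2Z normB2 exprVn.
  rewrite sqr_sqrtr ?ler0n//.
  rewrite n1 n2 d12; apply/eqP; by field.
have half : 2^-1 *: (y1 - y2) =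
    (Num.sqrt 3 / 2) *: ((Num.sqrt 3)^-1 *: (y1 - y2)).
  by rewrite scalerA mulrAC divff// mul1r.
exists y0, ((Num.sqrt 3)^-1 *: (y1 - y2)).
split=> //; [split=> // | |].
- exact/eqP.
- by apply/eqP; rewrite -normr_eq0 -vE normr_eq0.
- rewrite dotZr y0E !(dotDl, dotDr, dotNr) !dotE (dotC y2 y1) n1 n2.
  by ring.
- rewrite -half y0E -scalerDr addrACA subrr addr0 -mulr2n -(scaler_nat 2 y1).
  rewrite scalerA.
  by rewrite mulVf// scale1r.
- rewrite -half y0E -scalerBr opprB addrC addrA subrK -mulr2n -(scaler_nat 2 y2).
  by rewrite scalerA mulVf// scale1r.
Qed.

Section vanishing_sum.
Variables (y : nat -> H) (c : R).
Hypothesis flip1 : forall i, `|2 *: y i| = 0 \/ `|2 *: y i| = c.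
Hypothesis flip2 : forall i j, i != j ->
  `|2 *: y i + 2 *: y j| = 0 \/ `|2 *: y i + 2 *: y j| = c.

Lemma vanishing_norm i : y i != 0 -> 4 * `|y i| ^+ 2 = c ^+ 2.
Proof.
move=> yi; case: (flip1 i) => [/eqP|<-].
  by rewrite normr_eq0 scaler_eq0 pnatr_eq0/= (negbTE yi).
by rewrite norm2Z; ring.
Qed.

(** The squared norm of [2 y i + 2 y j] is [2 c ^ 2 + 8 dot (y i) (y j)] and is at most [c ^ 2]. *)
Lemma vanishing_obtuse i j : i != j -> y i != 0 -> y j != 0 ->
  8 * dot (y i) (y j) <= - c ^+ 2.
Proof.
move=> ij /vanishing_norm yi /vanishing_norm yj.
have := normD2 (2 *: y i) (2 *: y j); rewrite dotZl dotZr !norm2Z.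
have := sqr_ge0 c.
by case: (flip2 ij) => ->; rewrite ?expr0n/=; lra.
Qed.

(* Four vectors of length c/2 with pairwise inner products at most -c^2/8
   would have a sum of negative squared length. *)
Lemma vanishing_size (s : seq nat) : c != 0 -> uniq s ->
  all (fun i => y i != 0) s -> (size s <= 3)%N.
Proof.
move=> c0; case: s => [|i [|j [|k [|l s]]]]//=.
rewrite !inE !negb_or -!andbA.
move=> /and5P[ij ik il _ /and5P[jk jl _ kl _]] /and5P[yi yj yk yl _].
have := sqr_ge0 `|y i + y j + y k + y l|.
have c2 : 0 < c ^+ 2 by rewrite exprn_even_gt0.
rewrite !normD2 !dotDl.
have := vanishing_norm yi; have := vanishing_norm yj.
have := vanishing_norm yk; have := vanishing_norm yl.
have := vanishing_obtuse ij yi yj; have := vanishing_obtuse ik yi yk.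
have := vanishing_obtuse il yi yl; have := vanishing_obtuse jk yj yk.
have := vanishing_obtuse jl yj yl; have := vanishing_obtuse kl yk yl.
by lra.
Qed.

End vanishing_sum.

End real_inner_product.

(** * Finite supports and permutations of the natural numbers *)

(** A duplicate-free list of maximal length among those satisfying [p] exhausts [p], since otherwise
    it could be prolonged. *)
Lemma enum_bounded_pred (p : pred nat) n :
  (forall s, uniq s -> all p s -> (size s <= n)%N) ->
  exists s, uniq s /\ forall i, (i \in s) = p i.
Proof.
move=> sn; pose Q k := `[< exists s, [/\ uniq s, all p s & size s = k] >].
have Q0 : exists k, Q k by exists 0%N; apply/asboolP; exists [::].
have Qn k : Q k -> (k <= n)%N.
  by move=> /asboolP[s [us ps <-]]; exact: sn.
case: (ex_maxnP Q0 Qn) => k /asboolP[s [us ps sk]] kmax.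
exists s; split=> // i; apply/idP/idP => [/(allP ps)//|pi].
apply: contraT => nis; have := kmax k.+1; rewrite ltnn => ->//.
by apply/asboolP; exists (i :: s); split=> /=; rewrite ?nis ?pi ?sk.
Qed.

Lemma bijective_extension (t : seq nat) : uniq t ->
  exists s : nat -> nat, bijective s /\
    forall n, (n < size t)%N -> s n = nth 0%N t n.
Proof.
elim/last_ind: t => [_|t k IH]; first by exists id; split=> //; exists id.
rewrite rcons_uniq => /andP[nkt /IH[s [[g sg gs] sE]]].
(* The permutation obtained for [t] is precomposed with the transposition of m and [g k]. As k is
   not in [t], the index [g k] is at least m, so the values below m are unchanged. *)
pose m := size t; pose tau n := if n == m then g k else if n == g k then m else n.
have tauK : involutive tau.
  move=> n; rewrite /tau; have [->|nm] := eqVneq n m.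
    by have [//|] := eqVneq (g k) m; rewrite eqxx.
  by have [->|ngk] := eqVneq n (g k); rewrite ?eqxx// (negbTE nm) (negbTE ngk).
exists (s \o tau); split; first by apply: bij_comp; [exists g|exists tau].
move=> n; rewrite size_rcons ltnS leq_eqVlt => /predU1P[->|nt]/=.
  by rewrite /tau eqxx gs nth_rcons ltnn eqxx.
rewrite nth_rcons nt /tau ltn_eqF//; case: eqVneq => [ngk|_]; last exact: sE.
by move: nkt; rewrite -(gs k) -ngk sE// mem_nth.
Qed.

(** * Measurable functions with finitely many values *)

Section finitely_valued_functions.
Context d (T : measurableType d).

(** This is [simple_fun] with an arbitrary codomain, so that vectors, scalars, pairs and bits are
    treated alike. *)
Definition finitely_valued (C : Type) (f : T -> C) : Prop :=
  finite_set (range f) /\ forall y, measurable (f @^-1` [set y]).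

Lemma finitely_valued_preimage (C : choiceType) (f : T -> C) (Z : set C) :
  finitely_valued f -> measurable (f @^-1` Z).
Proof.
move=> [ff mf].
rewrite (_ : f @^-1` Z = \bigcup_(y in range f `&` Z) (f @^-1` [set y])).
  by apply: fin_bigcup_measurable => //; exact: finite_setIl.
apply/seteqP; split=> [w Zw|w [y [_ Zy]] /= ->//].
by exists (f w) => //; split=> //; exists w.
Qed.

Lemma finitely_valued_comp2 (A B C : choiceType) (F : A -> B -> C)
    (f : T -> A) (g : T -> B) : finitely_valued f -> finitely_valued g ->
  finitely_valued (fun w => F (f w) (g w)).
Proof.
move=> [ff mf] [fg mg]; split.
  apply: (@sub_finite_set _ _ ((fun ab => F ab.1 ab.2) @` (range f `*` range g))).
    by move=> _ [w _ <-]; exists (f w, g w).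
  by apply: finite_image; exact: finite_setX.
move=> y.
have fgfv : finitely_valued (fun w => (f w, g w)).
  split; first by apply: sub_finite_set (finite_setX ff fg) => _ [w _ <-];
    split=> /=; exact: imageT.
  move=> [a b]; rewrite (_ : _ @^-1` _ = f @^-1` [set a] `&` g @^-1` [set b]).
    exact: measurableI.
  by apply/seteqP; split=> w /=; [case=> -> ->|case=> <- <-].
exact: (@finitely_valued_preimage _ _ [set ab | F ab.1 ab.2 = y] fgfv).
Qed.

Lemma finitely_valued_cst (C : Type) (y : C) : finitely_valued (fun _ : T => y).
Proof.
split.
  by apply: (@sub_finite_set _ _ [set y]) => // _ [w _ <-].
move=> z; have [->|yz] := pselect (y = z).
  by rewrite (_ : _ @^-1` _ = setT)//; apply/seteqP; split.
by rewrite (_ : _ @^-1` _ = set0)//; apply/seteqP; split.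
Qed.

Lemma finitely_valued_indic (R : realType) (A : set T) : measurable A ->
  finitely_valued (\1_A : T -> R).
Proof.
move=> mA; split.
  apply: (@sub_finite_set _ _ [set 0; 1]) => // _ [w _ <-]; rewrite indicE.
  by case: (w \in A); [right|left].
move=> z; rewrite -[X in measurable X]setTI.
exact: (@measurable_indic _ _ R setT A mA measurableT [set z]).
Qed.

End finitely_valued_functions.

(** * Strongly measurable vector-valued functions *)

Section strong_measurability.
Context (R : realType) (H : completeNormedModType R).
Context d (T : measurableType d).
Implicit Types f g : T -> H.

Lemma strongly_measurableD f g : strongly_measurable f -> strongly_measurable g ->
  strongly_measurable (fun w => f w + g w).
Proof.
move=> [s [ss sf]] [t [st tg]]; exists (fun n w => s n w + t n w); split.
  by move=> n; exact: (finitely_valued_comp2 +%R (ss n) (st n)).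
by move=> w; apply: cvgD.
Qed.

Lemma strongly_measurableZ (h : T -> R) f : finitely_valued h ->
  strongly_measurable f -> strongly_measurable (fun w => h w *: f w).
Proof.
move=> fh [s [ss sf]]; exists (fun n w => h w *: s n w); split.
  by move=> n; exact: (finitely_valued_comp2 *:%R fh (ss n)).
by move=> w; apply: cvgZr.
Qed.

(** The norms of the approximating simple functions are measurable real functions that converge
    pointwise. *)
Lemma measurable_norm_strongly f : strongly_measurable f ->
  measurable_fun setT (fun w => `|f w|).
Proof.
move=> [s [ss sf]].
apply: (@measurable_fun_cvg _ _ _ _ (fun n w => `|s n w|)).
  move=> n _ Y mY; rewrite setTI.
  exact: (@finitely_valued_preimage _ _ _ _ ((fun u => `|u|) @^-1` Y) (ss n)).
by move=> w _; apply: cvg_norm.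
Qed.

Context (dot : {dot H for idfun}).
Hypothesis dotE : forall u : H, dot u u = `|u| ^+ 2.

(** Polarisation reduces the inner product to norms. *)
Lemma measurable_dot_strongly f g :
  strongly_measurable f -> strongly_measurable g ->
  measurable_fun setT (fun w => dot (f w) (g w)).
Proof.
move=> mf mg.
have -> : (fun w => dot (f w) (g w)) =
    (fun w => (2^-1 * (`|f w + g w| ^+ 2 - `|f w| ^+ 2 - `|g w| ^+ 2))).
  by apply/funext => w; rewrite (normD2 dotE); field.
apply: measurable_funM => //.
by do !apply: measurable_funB; apply: measurable_funX;
  apply: measurable_norm_strongly => //; exact: strongly_measurableD.
Qed.

End strong_measurability.

(** * Functions of two-valued norm are Hilbert points for the essential supremum norm *)

Section hilbert_points.
Context (R : realType) (H : completeNormedModType R) (dot : {dot H for idfun}).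
Hypothesis dotE : forall u : H, dot u u = `|u| ^+ 2.
Context d (T : measurableType d) (mu : probability T R).
Implicit Types f g phi : T -> H.

Lemma norm_Lp_oo f : norm_Lp mu +oo f = ess_sup mu (fun w => `|f w|%:E).
Proof.
have muT : (0 < mu setT)%E by rewrite probability_setT lte01.
rewrite /norm_Lp unlock; case: ifPn => [_|]; last by rewrite muT.
by congr (ess_sup mu _); apply/funext => w /=; rewrite normr_id.
Qed.

Lemma norm_Lp_fin (r : R) f :
  norm_Lp mu r%:E f = ((\int[mu]_w (`|f w| `^ r)%:E) `^ r^-1)%E.
Proof.
rewrite /norm_Lp unlock; congr (_ `^ _)%E.
by apply: eq_integral => w _; rewrite /= normr_id.
Qed.

Lemma two_valued_hilbert_point phi (c : R) : strongly_measurable phi ->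
  (forall w, `|phi w| = 0 \/ `|phi w| = c) ->
  ~ {ae mu, forall w, phi w = 0} -> hilbert_point dot mu +oo phi.
Proof.
move=> mphi phic phin0.
have muT : (0 < mu setT)%E by rewrite probability_setT lte01.
have c0 : 0 < c.
  rewrite ltNge; apply/negP => cle0; apply: phin0; apply/aeW => w.
  by apply/normr0_eq0; case: (phic w) => // wc; apply/le_anti; rewrite {1}wc cle0/=.
have phile w : `|phi w| <= c by case: (phic w) => -> //; exact: ltW.
have Nphi : (norm_Lp mu +oo phi <= c%:E)%E.
  by rewrite norm_Lp_oo; apply/ess_supP/aeW => w; rewrite lee_fin.
split => //; first by split=> //; exact: le_lt_trans Nphi (ltry _).
move=> f [mf _]; rewrite /orthogonal_Lp ltNge leey/= => f_phi.
rewrite leNgt; apply/negP => /lt_le_trans/(_ Nphi); rewrite norm_Lp_oo => ltc.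
have [m m_c mP] : exists2 m : R, m < c & \forall w \ae mu, `|phi w + f w| <= m.
  have := ess_sup_ge mu (fun w => `|phi w + f w|%:E).
  have : (0 <= ess_sup mu (fun w => `|phi w + f w|%:E))%E.
    by apply: ess_sup_gee => //; apply/aeW => w; rewrite lee_fin.
  case: (ess_sup mu _) ltc => [m|//|//]; rewrite lte_fin => mc _ mP.
  by exists m => //; apply: filterS mP => w; rewrite lee_fin.
(* Cauchy-Schwarz bounds [dot (phi + f) phi] by [m |phi|], while [|phi| ^ 2 = c |phi|] because the
   norm only takes the values 0 and c. *)
have dle : \forall w \ae mu, dot (f w) (phi w) <= - ((c - m) * `|phi w|).
  apply: filterS mP => w wm.
  have := dot_cauchy_schwarz dotE (phi w + f w) (phi w).
  rewrite dotDl dotE => ?.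
  have := ler_wpM2r (normr_ge0 (phi w)) wm.
  have : `|phi w| ^+ 2 = c * `|phi w|.
    by case: (phic w) => ->; rewrite ?mulr0 ?expr0n.
  by lra.
have md := measurable_dot_strongly dotE mf mphi.
(* The pairing is almost everywhere nonpositive and integrates to 0, so it vanishes almost
   everywhere. *)
have d0 : \forall w \ae mu, dot (f w) (phi w) = 0.
  have mde : measurable_fun setT (fun w => (dot (f w) (phi w))%:E).
    exact/measurable_EFinP.
  have : (\int[mu]_w `|(dot (f w) (phi w))%:E| = 0)%E.
    rewrite -[LHS]oppeK -integral_ge0N//.
    have mNd : measurable_fun setT (fun w => - `|(dot (f w) (phi w))%:E|)%E.
      by apply: measurableT_comp => //; apply: measurableT_comp.
    suff /(ae_eq_integral _ _ measurableT mde mNd) <- :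
        ae_eq mu setT (fun w => (dot (f w) (phi w))%:E)
          (fun w => - `|(dot (f w) (phi w))%:E|)%E
      by rewrite [X in oppe X]f_phi oppe0.
    apply: filterS dle => w wle _ /=; congr EFin; rewrite ler0_norm ?opprK//.
    by rewrite (le_trans wle)// oppr_le0 mulr_ge0// subr_ge0 ltW.
  move=> /(ae_eq_integral_abs mu measurableT mde).
  by apply: filterS => w /(_ I) [].
apply: phin0; apply: filterS2 d0 dle => w -> wle; apply/normr0_eq0/le_anti.
rewrite normr_ge0 andbT -(pmulr_rle0 _ (_ : 0 < c - m)) ?subr_gt0//.
by rewrite -oppr_ge0.
Qed.

End hilbert_points.

(** * Perturbation of two level sets *)

(** The right-hand side of the inequality, as a function of t, has an interior minimum at 0, where
    its derivative is [r (P x - Q y)]. The bounds on [e] keep both bases positive, hence the powers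
    differentiable. *)
Lemma stationary_power_combination (R : realType) (r P Q x y e : R) :
  0 < e -> 0 <= P -> 0 <= Q -> e * P < 1 -> e * Q < 1 -> r != 0 ->
  (forall t, - e < t < e ->
    x + y <= (1 + t * P) `^ r * x + (1 - t * Q) `^ r * y) ->
  P * x = Q * y.
Proof.
move=> e0 P0 Q0 eP eQ r0 tmin.
pose f t := x * (1 + t * P) `^ r + y * (1 - t * Q) `^ r.
have dpow (k t : R) : 0 < 1 + t * k ->
    is_derive t 1 (fun t => (1 + t * k) `^ r) (r * (1 + t * k) `^ (r - 1) * k).
  move=> tk0; apply: (@is_derive1_comp _ (fun z => z `^ r) (fun t => 1 + t * k)).
    exact: is_derive1_powR.
  rewrite (_ : (fun t => 1 + t * k) = cst 1 + k \*: id); last first.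
    by apply/funext => z; rewrite !fctE/= mulrC.
  by apply: is_derive_eq; rewrite add0r [_ *: _]mulr1.
have df t : - e < t < e -> is_derive t 1 f
    (x * (r * (1 + t * P) `^ (r - 1) * P) +
     y * (r * (1 + t * - Q) `^ (r - 1) * - Q)).
  move=> te.
  have tP : 0 < 1 + t * P by nra.
  have tQ : 0 < 1 + t * - Q by nra.
  have dP := dpow _ _ tP; have dQ := dpow _ _ tQ.
  rewrite (_ : f = x \*: (fun t => (1 + t * P) `^ r) +
     y \*: (fun t => (1 + t * - Q) `^ r)); last first.
    by apply/funext => z; rewrite !fctE/= mulrN.
  exact: is_deriveD.
have f0 : is_derive (0 : R) (1 : R) f 0.
  apply: (@derive1_at_min _ f (- e) e); first lra.
  - by move=> t; rewrite in_itv/= => /df[].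
  - by rewrite in_itv/=; lra.
  - move=> t; rewrite in_itv/= => /tmin.
    by rewrite /f !mul0r subr0 addr0 !powR1 !mulr1 [x * _]mulrC [y * _]mulrC.
have /df f0' : - e < 0 < e by lra.
have := @derive_val _ _ _ _ _ _ _ f0; rewrite derive_val !mul0r !addr0 !powR1.
rewrite !mulr1 => E; apply/eqP; rewrite -subr_eq0 -(mulrI_eq0 _ (lregP r0)).
by apply/eqP; rewrite -[RHS]E; ring.
Qed.

Section two_level_sets.
Context (R : realType) d (T : measurableType d) (mu : probability T R).
Variables (N : T -> R) (A B : set T) (a b M : R).
Hypotheses (mN : measurable_fun setT N) (N0 : forall w, 0 <= N w).
Hypotheses (mA : measurable A) (mB : measurable B).
Hypotheses (muA : mu A != 0%E) (muB : mu B != 0%E).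
Hypotheses (a0 : 0 < a) (ab : a < b).
Hypotheses (NA : forall w, A w -> 0 < N w <= a).
Hypotheses (NB : forall w, B w -> b <= N w <= M).

Definition level_power (S : set T) (r : R) : R := \int[mu]_(w in S) (N w `^ r).

Lemma measurable_level_power (r : R) (S : set T) :
  measurable_fun S (fun w => N w `^ r).
Proof.
apply: (@measurable_funS _ _ _ _ setT) => //.
exact: (measurableT_comp (measurable_powR r) mN).
Qed.

Lemma bounded_level_integrable (S : set T) (K r : R) : 0 <= r -> measurable S ->
  (forall w, S w -> N w <= K) -> mu.-integrable S (EFin \o (fun w => N w `^ r)).
Proof.
move=> r0 mS NK; apply: measurable_bounded_integrable => //.
- by rewrite (le_lt_trans (probability_le1 _ _))// ltry.
- exact: measurable_level_power.
exists (K `^ r); split; first exact: num_real.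
move=> z Kz w Sw /=; rewrite ger0_norm ?powR_ge0// (le_trans _ (ltW Kz))//.
have NwK := NK _ Sw.
by rewrite ge0_ler_powR ?nnegrE// (le_trans (N0 w)).
Qed.

Let iA (r : R) : 0 <= r -> mu.-integrable A (EFin \o (fun w => N w `^ r)).
Proof.
by move=> r0; apply: (@bounded_level_integrable _ a) => // w /NA/andP[].
Qed.

Let iB (r : R) : 0 <= r -> mu.-integrable B (EFin \o (fun w => N w `^ r)).
Proof.
by move=> r0; apply: (@bounded_level_integrable _ M) => // w /NB/andP[].
Qed.

Lemma level_power_gt0 (S : set T) (r : R) : measurable S -> mu S != 0%E ->
  (forall w, S w -> 0 < N w) -> mu.-integrable S (EFin \o (fun w => N w `^ r)) ->
  0 < level_power S r.
Proof.
move=> mS muS NS iS; rewrite lt_neqAle Rintegral_ge0 ?andbT; last first.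
  by move=> w _; exact: powR_ge0.
apply: contra_neq muS => J0.
have : (\int[mu]_(w in S) `|(N w `^ r)%:E| = 0)%E.
  under eq_integral do rewrite gee0_abs ?lee_fin ?powR_ge0//.
  by rewrite -[LHS]fineK ?(integrable_fin_num mS iS)// -[fine _]J0.
move=> /(ae_eq_integral_abs mu mS)-/(_ (measurable_int mu iS)) S0.
apply/(negligibleP _ mS).
apply: negligibleS S0 => w Sw /(_ Sw)[] /powR_eq0_eq0 Nw0.
by have := NS _ Sw; rewrite Nw0 ltxx.
Qed.

Let A0 w : A w -> 0 < N w. Proof. by move=> /NA/andP[]. Qed.

Let B0 w : B w -> 0 < N w.
Proof. by move=> /NB/andP[bN _]; rewrite (lt_le_trans _ bN)// (lt_trans a0). Qed.

(** Raising the exponent from s to t multiplies the integral over [A] by at most [a ^ (t - s)] and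
    the one over [B] by at least the larger [b ^ (t - s)]. With 2 as one of the exponents, this
    strict inequality rules out stationarity. *)
Lemma level_power_ltr (s t : R) : 0 < s -> s < t ->
  level_power A t * level_power B s < level_power A s * level_power B t.
Proof.
move=> s0 st; have t0 : 0 < t by exact: lt_trans st.
have ts0 : 0 < t - s by rewrite subr_gt0.
have NE w : N w `^ t = N w `^ (t - s) * N w `^ s.
  by rewrite -powRD subrK// gt_eqF.
have JA : level_power A t <= a `^ (t - s) * level_power A s.
  rewrite /level_power -RintegralZl//; last exact: iA (ltW _).
  apply: le_Rintegral => //; first exact: iA (ltW _).
    by rewrite /comp/=; under eq_fun do rewrite EFinM;
      apply: integrableZl => //; exact: iA (ltW _).
  move=> w /NA/andP[_ Na]; rewrite NE ler_wpM2r ?powR_ge0// ge0_ler_powR ?nnegrE//.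
  - exact: ltW.
  - exact: ltW.
have JB : b `^ (t - s) * level_power B s <= level_power B t.
  rewrite /level_power -RintegralZl//; last exact: iB (ltW _).
  apply: le_Rintegral => //; last 2 [exact: iB (ltW _)].
    by rewrite /comp/=; under eq_fun do rewrite EFinM;
      apply: integrableZl => //; exact: iB (ltW _).
  move=> w /NB/andP[bN _]; rewrite NE ler_wpM2r ?powR_ge0// ge0_ler_powR ?nnegrE//.
  - exact: ltW.
  - by rewrite ltW// (lt_trans a0).
have pA := level_power_gt0 mA muA A0 (iA (ltW s0)).
have pB := level_power_gt0 mB muB B0 (iB (ltW s0)).
apply: (le_lt_trans (ler_wpM2r (ltW pB) JA)).
apply: (lt_le_trans _ (ler_wpM2l (ltW pA) JB)).
rewrite -mulrA mulrCA ltr_pM2l// ltr_pM2r// gt0_ltr_powR ?nnegrE//.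
- exact: ltW.
- by rewrite ltW// (lt_trans a0).
Qed.

End two_level_sets.

(** * Rescaling a Hilbert point on two level sets of its norm *)

Section scaling_a_hilbert_point.
Context (R : realType) (H : completeNormedModType R) (dot : {dot H for idfun}).
Hypothesis dotE : forall u : H, dot u u = `|u| ^+ 2.
Context d (T : measurableType d) (mu : probability T R).
Implicit Types (f phi : T -> H) (p : \bar R).

Lemma bounded_in_Lp p f (K : R) : (1 <= p)%E -> strongly_measurable f ->
  (forall w, `|f w| <= K) -> in_Lp mu p f.
Proof.
move=> p1 mf fK; split=> //; case: p p1 => [r| |//] p1; last first.
  rewrite norm_Lp_oo; apply: (@le_lt_trans _ _ K%:E); last exact: ltry.
  by apply/ess_supP/aeW => w; rewrite lee_fin.
rewrite norm_Lp_fin poweR_lty// (@le_lt_trans _ _ (\int[mu]_w (K `^ r)%:E)%E)//.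
  apply: ge0_le_integral => //.
  - apply/measurable_EFinP; apply: (measurableT_comp (measurable_powR r)).
    exact: measurable_norm_strongly.
  - move=> w _; rewrite lee_fin ge0_ler_powR ?nnegrE//.
      by rewrite (le_trans ler01)// -lee_fin.
    by rewrite (le_trans _ (fK w)).
by rewrite integral_cst// [X in (_ * X)%E]probability_setT mule1 ltry.
Qed.

(** The perturbation [h phi] is bounded, so it lies in every L^p; for p below 2 it serves as its own
    bounded approximant in the definition of orthogonality. *)
Lemma hilbert_point_scaling p phi (h : T -> R) (K : R) : (1 <= p)%E ->
  hilbert_point dot mu p phi -> finitely_valued h ->
  (forall w, `|h w| * `|phi w| <= K) ->
  (\int[mu]_w (h w * `|phi w| ^+ 2)%:E = 0)%E ->
  (norm_Lp mu p phi <= norm_Lp mu p (fun w => (1 + h w) *: phi w))%E.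
Proof.
move=> p1 [[mphi _] _ phiH] fh hK h0.
have mhphi := strongly_measurableZ fh mphi.
have hphiK w : `|h w *: phi w| <= K by rewrite normrZ.
have hphi_Lp q : (1 <= q)%E -> in_Lp mu q (fun w => h w *: phi w).
  by move=> q1; exact: bounded_in_Lp mhphi hphiK.
have orth : inner_Lp dot mu (fun w => h w *: phi w) phi = 0%E.
  rewrite /inner_Lp -[RHS]h0; apply: eq_integral => w _.
  by rewrite dotZl dotE.
have -> : (fun w => (1 + h w) *: phi w) = (fun w => phi w + h w *: phi w).
  by apply/funext => w; rewrite scalerDl scale1r.
apply: phiH; first exact: hphi_Lp.
rewrite /orthogonal_Lp; case: ifPn => // _ e e0.
exists (fun w => h w *: phi w); split=> //; first by apply: hphi_Lp; rewrite leey.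
rewrite /norm_Lp; under eq_Lnorm do rewrite subrr normr0.
by rewrite Lnorm0 ?lte_fin// gt_eqF// (lt_le_trans _ p1)// lte01.
Qed.

(** For p infinite, a small positive t lowers the essential supremum. For finite p both signs of t
    are admissible, and the resulting stationarity at t = 0 contradicts [level_power_ltr]. *)
Lemma hilbert_point_two_levels p phi (a b M : R) : (1 <= p)%E -> p <> 2%:E ->
  hilbert_point dot mu p phi -> 0 < a -> a < b ->
  (p = +oo%E -> norm_Lp mu p phi = M%:E /\ b < M) ->
  mu [set w | 0 < `|phi w| <= a] != 0%E ->
  mu [set w | b <= `|phi w| <= M] != 0%E -> False.
Proof.
move=> p1 p2 phiH a0 ab pM.
set A := [set w | _]; set B := [set w | b <= _ <= _] => muA muB.
have [[mphi Nphi] _ _] := phiH.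
pose N w := `|phi w|.
have mN : measurable_fun setT N by exact: measurable_norm_strongly.
have N0 w : 0 <= N w by exact: normr_ge0.
have mA : measurable A.
  rewrite (_ : A = setT `&` N @^-1` `]0, a]); last first.
    by rewrite setTI; apply/seteqP; split=> w /=; rewrite in_itv.
  by apply: mN => //; exact: measurable_itv.
have mB : measurable B.
  rewrite (_ : B = setT `&` N @^-1` `[b, M]); last first.
    by rewrite setTI; apply/seteqP; split=> w /=; rewrite in_itv.
  by apply: mN => //; exact: measurable_itv.
have NA w : A w -> 0 < N w <= a by [].
have NB w : B w -> b <= N w <= M by [].
have A0 w : A w -> 0 < N w by case/NA/andP.
have B0 w : B w -> 0 < N w.
  by move=> /NB/andP[bN _]; rewrite (lt_le_trans _ bN)// (lt_trans a0).
have AB w : A w -> B w -> False.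
  move=> /NA/andP[_ Na] /NB/andP[bN _].
  by have := lt_le_trans ab (le_trans bN Na); rewrite ltxx.
have iA r : 0 <= r -> mu.-integrable A (EFin \o (fun w => N w `^ r)).
  move=> r0; apply: (@bounded_level_integrable _ _ _ _ _ _ _ _ a) => // w.
  by move=> /NA/andP[].
have iB r : 0 <= r -> mu.-integrable B (EFin \o (fun w => N w `^ r)).
  move=> r0; apply: (@bounded_level_integrable _ _ _ _ _ _ _ _ M) => // w.
  by move=> /NB/andP[].
have pA r : 0 <= r -> 0 < level_power mu N A r.
  by move=> r0; apply: level_power_gt0 => //; exact: iA.
have pB r : 0 <= r -> 0 < level_power mu N B r.
  by move=> r0; apply: level_power_gt0 => //; exact: iB.
(* The weights on A and B are chosen so that h t is orthogonal to N ^ 2. *)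
pose P := level_power mu N B 2; pose Q := level_power mu N A 2.
have P0 : 0 < P by exact: pB.
have Q0 : 0 < Q by exact: pA.
pose h (t : R) w : R := t * P * \1_A w - t * Q * \1_B w.
have hA t w : A w -> h t w = t * P.
  move=> Aw; rewrite /h !indicE mem_set// memNset ?mulr1 ?mulr0 ?subr0//.
  by move=> /(AB _ Aw).
have hB t w : B w -> h t w = - (t * Q).
  move=> Bw; rewrite /h !indicE [w \in B]mem_set// memNset ?mulr1 ?mulr0 ?sub0r//.
  by move=> /AB/(_ Bw).
have hD t w : (~` (A `|` B)) w -> h t w = 0.
  by move=> /not_orP[nA nB]; rewrite /h !indicE !memNset// !mulr0 subr0.
pose psi t w := (1 + h t w) *: phi w.
have fh t : finitely_valued (h t).
  apply: (finitely_valued_comp2 (fun x y => t * P * x - t * Q * y));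
    exact: finitely_valued_indic.
have mpsi t : measurable_fun setT (fun w => `|psi t w|).
  apply: measurable_norm_strongly; apply: strongly_measurableZ => //.
  exact: (finitely_valued_comp2 +%R
    (finitely_valued_cst T (1 : R)) (fh t)).
have split3 (g : T -> R) : mu.-integrable setT (EFin \o g) ->
    \int[mu]_w g w = \int[mu]_(w in A) g w + \int[mu]_(w in B) g w +
                     \int[mu]_(w in ~` (A `|` B)) g w.
  move=> ig; have mAB := measurableU _ _ mA mB.
  rewrite -Rintegral_setU//; last 2 first.
  - exact: integrableS ig.
  - by apply/eqP/seteqP; split=> w // -[/AB].
  rewrite -Rintegral_setU ?setUv//; first exact: measurableC.
  by apply/eqP; rewrite setICr.
have ABD w : [\/ A w, B w | (~` (A `|` B)) w].
  by have [|] := pselect (A w); have [|] := pselect (B w);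
    [constructor 1|constructor 1|constructor 2|constructor 3; case].
have hK t w : `|h t w| * `|phi w| <= `|t| * P * a + `|t| * Q * `|M|.
  have tPa : 0 <= `|t| * P * a by rewrite !mulr_ge0// ltW.
  have tQM : 0 <= `|t| * Q * `|M| by rewrite !mulr_ge0// ltW.
  case: (ABD w) => [Aw|Bw|Dw].
  - rewrite (hA _ _ Aw) normrM (gtr0_norm P0) -[leLHS]addr0 lerD//.
    by apply: ler_wpM2l; [rewrite mulr_ge0// ltW|case/NA/andP: Aw].
  - rewrite (hB _ _ Bw) normrN normrM (gtr0_norm Q0) -[leLHS]add0r lerD//.
    apply: ler_wpM2l; first by rewrite mulr_ge0// ltW.
    by case/NB/andP: Bw => _ /le_trans-> //; exact: ler_norm.
  - by rewrite (hD _ _ Dw) normr0 mul0r addr_ge0.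
have mh t : measurable_fun setT (h t).
  by move=> _ Y mY; rewrite setTI; exact: finitely_valued_preimage (fh t).
have N2 w : N w `^ 2 = `|phi w| ^+ 2 by rewrite -powR_mulrn.
have h0 t : (\int[mu]_w (h t w * `|phi w| ^+ 2)%:E = 0)%E.
  have ih : mu.-integrable setT (EFin \o (fun w => h t w * `|phi w| ^+ 2)).
    apply: measurable_bounded_integrable => //.
    - by rewrite -ge0_fin_numE//; exact: fin_num_measure.
    - by apply: measurable_funM => //; apply: measurable_funX.
    pose K := `|t| * P * a + `|t| * Q * `|M|.
    have K0 : 0 <= K by rewrite addr_ge0// !mulr_ge0// ltW.
    exists (K * (a + `|M|)); split; first exact: num_real.
    move=> z Kz w _ /=; rewrite (le_trans _ (ltW Kz))// expr2 mulrA normrM normrM.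
    rewrite normr_id; case: (ABD w) => [Aw|Bw|Dw].
    - apply: ler_pM; [by rewrite mulr_ge0|by []|exact: hK|].
      by case/NA/andP: Aw => _ /le_trans-> //; rewrite lerDl.
    - apply: ler_pM; [by rewrite mulr_ge0|by []|exact: hK|].
      case/NB/andP: Bw => _ /le_trans-> //; rewrite (le_trans (ler_norm M))//.
      by rewrite lerDr ltW.
    - by rewrite (hD _ _ Dw) normr0 !mul0r mulr_ge0// addr_ge0// ltW.
  rewrite -[LHS]fineK ?(integrable_fin_num measurableT ih)//; congr EFin.
  rewrite -[LHS]/(\int[mu]_w (h t w * `|phi w| ^+ 2)) split3//.
  rewrite (@eq_Rintegral _ _ _ mu A (fun w => t * P * N w `^ 2)); last first.
    by move=> w /set_mem Aw; rewrite (hA _ _ Aw) N2.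
  rewrite (@eq_Rintegral _ _ _ mu B (fun w => - (t * Q) * N w `^ 2)); last first.
    by move=> w /set_mem Bw; rewrite (hB _ _ Bw) N2.
  rewrite (@eq_Rintegral _ _ _ mu (~` (A `|` B)) (fun w => 0)); last first.
    by move=> w /set_mem Dw; rewrite (hD _ _ Dw) mul0r.
  rewrite !RintegralZl//; [|exact: iB|exact: iA].
  rewrite -/(level_power mu N A 2) -/(level_power mu N B 2) -/P -/Q.
  by rewrite [X in _ + X]Rintegral_cst ?mul0r; [ring|exact/measurableC/measurableU].
have key t : (norm_Lp mu p phi <= norm_Lp mu p (psi t))%E.
  exact: (@hilbert_point_scaling p phi (h t)).
case: p p1 p2 phiH pM key Nphi => [r| |//] p1 p2 phiH pM key Nphi; last first.
  have [NM bM] := pM erefl.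
  have M0 : 0 < M by rewrite (lt_trans _ bM)// (lt_trans a0).
  (* The first bound keeps the enlarged values on [A] at most b; the second keeps the factor
     [1 - t Q] on [B] nonnegative. *)
  pose t := Num.min ((b - a) / (P * a)) Q^-1.
  have t0 : 0 < t by rewrite lt_min invr_gt0 Q0 divr_gt0 ?mulr_gt0 ?subr_gt0.
  have tP : t * P * a <= b - a.
    by rewrite -mulrA -ler_pdivlMr ?mulr_gt0// ge_min lexx.
  have tQ : t * Q <= 1 by rewrite -ler_pdivlMr// div1r ge_min lexx orbT.
  have : (norm_Lp mu +oo (psi t) <= (Num.max b ((1 - t * Q) * M))%:E)%E.
    have := ess_sup_ge mu (fun w => `|phi w|%:E).
    rewrite -norm_Lp_oo NM norm_Lp_oo => NleM; apply/ess_supP.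
    apply: filterS NleM => w; rewrite !lee_fin => NwM; rewrite normrZ le_max.
    case: (ABD w) => [Aw|Bw|Dw].
    - apply/orP; left; rewrite (hA _ _ Aw) ger0_norm; last first.
        by rewrite addr_ge0// mulr_ge0// ltW.
      have /andP[_ Nwa] := NA _ Aw.
      rewrite mulrDl mul1r (le_trans (lerD Nwa (_ : _ <= t * P * a)))//.
        by rewrite ler_wpM2l// mulr_ge0// ltW.
      by rewrite -lerBrDl.
    - apply/orP; right; rewrite (hB _ _ Bw) ger0_norm ?subr_ge0//.
      by rewrite ler_wpM2l// subr_ge0.
    - apply/orP; left; rewrite (hD _ _ Dw) addr0 normr1 mul1r leNgt.
      apply/negP => bN; apply: Dw; right; apply/andP; split=> //; exact: ltW.
  move=> /(le_trans (key t)); rewrite NM lee_fin leNgt gt_max bM/=.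
  by rewrite gtr_pMl// ltrBlDr ltrDl mulr_gt0.
have r1 : 1 <= r by rewrite -lee_fin.
have r0 : 0 < r by rewrite (lt_le_trans ltr01).
have rn0 : r != 0 by rewrite gt_eqF.
have pow_norm f : ((norm_Lp mu r%:E f) `^ r = \int[mu]_w (`|f w| `^ r)%:E)%E.
  rewrite norm_Lp_fin -poweRrM mulVf// poweRe1//.
  by apply: integral_ge0 => w _; rewrite lee_fin powR_ge0.
have iN : mu.-integrable setT (EFin \o (fun w => N w `^ r)).
  apply/integrableP; split.
    by apply/measurable_EFinP; exact: measurable_level_power.
  under eq_integral do rewrite gee0_abs ?lee_fin ?powR_ge0//.
  by rewrite -pow_norm poweR_lty.
(* For [|t| < e] both factors lie between 0 and 2, which gives the integrable majorant
   [2 ^ r N ^ r]. *)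
pose e := (2 * (P + Q))^-1.
have PQ0 : 0 < 2 * (P + Q) by rewrite mulr_gt0// addr_gt0.
have e0 : 0 < e by rewrite invr_gt0.
have eP : e * P < 1 by rewrite mulrC ltr_pdivrMr// mul1r; lra.
have eQ : e * Q < 1 by rewrite mulrC ltr_pdivrMr// mul1r; lra.
have : P * level_power mu N A r = Q * level_power mu N B r.
  apply: (stationary_power_combination e0 (ltW P0) (ltW Q0) eP eQ rn0) => t te.
  have tP : 0 <= 1 + t * P <= 2 by nra.
  have tQ : 0 <= 1 - t * Q <= 2 by nra.
  have ht w : 0 <= 1 + h t w <= 2.
    case: (ABD w) => [Aw|Bw|Dw]; rewrite ?(hA _ _ Aw) ?(hB _ _ Bw) ?(hD _ _ Dw)//.
    by rewrite addr0 ler01 ler1n.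
  have psiE w : `|psi t w| `^ r = (1 + h t w) `^ r * N w `^ r.
    have /andP[ht0 _] := ht w.
    by rewrite /psi normrZ ger0_norm// powRM.
  have ipsi : mu.-integrable setT (EFin \o (fun w => `|psi t w| `^ r)).
    apply: (le_integrable measurableT _ _ (integrableZl measurableT (2 `^ r) iN)).
      apply/measurable_EFinP.
      exact: (measurableT_comp (measurable_powR r) (mpsi t)).
    move=> w _ /=; rewrite !lee_fin psiE !ger0_norm ?mulr_ge0 ?powR_ge0//.
    have /andP[ht0 ht2] := ht w.
    by rewrite ler_wpM2r ?powR_ge0// ge0_ler_powR ?nnegrE// ltW.
  have : \int[mu]_w (N w `^ r) <= \int[mu]_w (`|psi t w| `^ r).
    rewrite fine_le ?(integrable_fin_num measurableT)//.
    rewrite -!pow_norm gt0_ler_poweR ?in_itv/= ?leey ?Lnorm_ge0//.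
    exact: ltW.
  (* Off [A] and [B] the function is not modified, so these contributions cancel and only the two
     level sets are compared. *)
  rewrite !split3//.
  rewrite (@eq_Rintegral _ _ _ mu A (fun w => (1 + t * P) `^ r * N w `^ r)
    (fun w => `|psi t w| `^ r)); last first.
    by move=> w /set_mem Aw; rewrite psiE (hA _ _ Aw).
  rewrite (@eq_Rintegral _ _ _ mu B (fun w => (1 - t * Q) `^ r * N w `^ r)
    (fun w => `|psi t w| `^ r)); last first.
    by move=> w /set_mem Bw; rewrite psiE (hB _ _ Bw).
  rewrite (@eq_Rintegral _ _ _ mu (~` (A `|` B)) (fun w => N w `^ r)
    (fun w => `|psi t w| `^ r)); last first.
    by move=> w /set_mem Dw; rewrite psiE (hD _ _ Dw) addr0 powR1 mul1r.
  rewrite lerD2r !RintegralZl//; [exact: iB (ltW _)|exact: iA (ltW _)].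
have levels := level_power_ltr mN N0 mA mB muA muB a0 ab NA NB.
have [r2|r2|r2] := ltgtP r 2.
- by move=> E; have := levels _ _ r0 r2; rewrite -/P -/Q -E mulrC ltxx.
- move=> E; have := levels 2 r ltac:(by []) r2.
  by rewrite -/P -/Q -E mulrC ltxx.
- by rewrite r2 in p2.
Qed.


End scaling_a_hilbert_point.

(** * The norm of a Hilbert point takes at most one nonzero value *)

Section norm_of_a_hilbert_point.
Context (R : realType) (H : completeNormedModType R) (dot : {dot H for idfun}).
Hypothesis dotE : forall u : H, dot u u = `|u| ^+ 2.
Context d (T : measurableType d) (mu : probability T R).
Variables (phi : T -> H) (p : \bar R).
Hypotheses (p1 : (1 <= p)%E) (p2 : p <> 2%:E) (phiH : hilbert_point dot mu p phi).

Let mN : measurable_fun setT (fun w => `|phi w|).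
Proof. by apply: measurable_norm_strongly; case: phiH => -[]. Qed.

Let null_ae (P : T -> bool) (i : interval R) :
  (forall w, P w = (`|phi w| \in i)) -> mu [set w | P w] = 0%E ->
  {ae mu, forall w, ~ P w}.
Proof.
move=> PE P0; exists [set w | P w]; split=> //; last by move=> w /= /contrapT.
rewrite (_ : [set w | P w] = setT `&` (fun w => `|phi w|) @^-1` [set` i]).
  by apply: mN => //; exact: measurable_itv.
by rewrite setTI; apply/seteqP; split=> w /=; rewrite PE.
Qed.

(** This passes from the bounded upper level sets of [hilbert_point_two_levels] to the set where the
    norm is at least b. *)
Lemma hilbert_point_one_level (a b : R) : 0 < a -> a < b ->
  {ae mu, forall w, ~ (0 < `|phi w| <= a)} \/ {ae mu, forall w, ~ (b <= `|phi w|)}.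
Proof.
move=> a0 ab; have [|nA] := pselect {ae mu, forall w, ~ (0 < `|phi w| <= a)}.
  by left.
right; apply: contrapT => nB.
have muA : mu [set w | 0 < `|phi w| <= a] != 0%E.
  apply/eqP => /(@null_ae _ `]0, a]); apply: contra_not nA; apply => w.
  by rewrite in_itv.
have muB b' M : ~ {ae mu, forall w, ~ (b' <= `|phi w| <= M)} ->
    mu [set w | b' <= `|phi w| <= M] != 0%E.
  move=> nBM; apply/eqP => /(@null_ae _ `[b', M]).
  by apply: contra_not nBM; apply => w; rewrite in_itv.
have Nphi : (norm_Lp mu p phi < +oo)%E by case: phiH => -[].
have [poo|poo] := pselect (p = +oo%E).
  pose M := fine (norm_Lp mu p phi).
  have NM : norm_Lp mu p phi = M%:E.
    by rewrite fineK// ge0_fin_numE// Lnorm_ge0.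
  have NleM : {ae mu, forall w, `|phi w| <= M}.
    have := ess_sup_ge mu (fun w => `|phi w|%:E).
    by rewrite -norm_Lp_oo -poo NM; apply: filterS => w; rewrite lee_fin.
  have bM : b <= M.
    rewrite leNgt; apply/negP => Mb; apply: nB; apply: filterS NleM => w NwM.
    by apply/negP; rewrite -ltNge (le_lt_trans NwM).
  (* The upper level has to lie strictly below M, whereas b may equal M; the midpoint leaves room on
     both sides. *)
  pose b' := (a + b) / 2.
  have ab' : a < b' by rewrite /b'; lra.
  have b'b : b' < b by rewrite /b'; lra.
  apply: (hilbert_point_two_levels dotE p1 p2 phiH a0 ab' (M := M)) => //.
    by move=> _; rewrite (lt_le_trans b'b).
  apply: muB => nBM; apply: nB; apply: filterS2 NleM nBM => w -> /negP.
  by rewrite andbT -ltNge => Nb; apply/negP; rewrite -ltNge (lt_trans Nb).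
(* The set where the norm is at least b is the countable union of its parts where the norm is at
   most n, so one part is not negligible. *)
have [n nBn] : exists n : nat, ~ {ae mu, forall w, ~ (b <= `|phi w| <= n%:R)}.
  apply: contrapT => /forallNP allB; apply: nB.
  have : {ae mu, forall w, forall n : nat, ~ (b <= `|phi w| <= n%:R)}.
    by apply: ae_foralln => n; exact: contrapT (allB n).
  apply: filterS => w Nw bN; apply: (Nw (Num.truncn `|phi w|).+1).
  by rewrite bN ltW// truncnS_gt.
apply: (hilbert_point_two_levels dotE p1 p2 phiH a0 ab (M := n%:R)) => //.
exact: muB.
Qed.

Lemma hilbert_point_norm_two_valued :
  exists2 c : R, 0 < c & {ae mu, forall w, `|phi w| = 0 \/ `|phi w| = c}.
Proof.
have phin0 : ~ {ae mu, forall w, phi w = 0} by case: phiH.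
(* The nonzero value c is the supremum of the levels a for which the norm almost surely avoids []0,
   a]]; this set is bounded because [phi] is not almost surely 0. *)
pose E := [set a : R | 0 <= a /\ {ae mu, forall w, ~ (0 < `|phi w| <= a)}].
have Edown a a' : a <= a' -> E a' -> {ae mu, forall w, ~ (0 < `|phi w| <= a)}.
  move=> aa' [_]; apply: filterS => w /[swap] /andP[Nw Na]; apply.
  by rewrite Nw (le_trans Na).
have E0 : E 0.
  by split=> //; apply/aeW => w /andP[/lt_le_trans h /h]; rewrite ltxx.
have supE : has_sup E.
  split; first by exists 0.
  apply: contrapT => noub; apply: phin0.
  have : {ae mu, forall w, forall n : nat, ~ (0 < `|phi w| <= n%:R)}.
    apply: ae_foralln => n.
    have [a Ea na] : exists2 a, E a & n%:R <= a.
      apply: contrapT => /forall2NP nE; apply: noub; exists n%:R => a Ea.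
      by case: (nE a) => // /negP; rewrite -ltNge => /ltW.
    exact: Edown Ea.
  apply: filterS => w Nw; apply/eqP; rewrite -normr_eq0 eq_le normr_ge0 andbT.
  rewrite leNgt; apply/negP => Nw0; apply: (Nw (Num.truncn `|phi w|).+1).
  by rewrite Nw0 ltW// truncnS_gt.
pose c := sup E.
have c0 : 0 <= c by apply: ub_le_sup => //; case: supE.
have above : {ae mu, forall w, forall n : nat, ~ (c + n.+1%:R^-1 <= `|phi w|)}.
  apply: ae_foralln => n; pose e : R := n.+1%:R^-1.
  have e0 : 0 < e by rewrite invr_gt0.
  have ce0 : 0 < c + e / 2 by rewrite ltr_wpDl// divr_gt0.
  have cee : c + e / 2 < c + e by rewrite ltrD2l; lra.
  (* The first alternative would put [c + e / 2] into [E], above its supremum. *)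
  have [Ace|//] := hilbert_point_one_level ce0 cee.
  have : c + e / 2 <= c.
    by apply: ub_le_sup; [case: supE|split=> //; exact: ltW].
  by rewrite gerDl leNgt divr_gt0.
have below : {ae mu, forall w, forall n : nat, ~ (0 < `|phi w| <= c - n.+1%:R^-1)}.
  apply: ae_foralln => n.
  have n0 : 0 < n.+1%:R^-1 :> R by rewrite invr_gt0.
  have [a Ea /ltW ca] := sup_adherent n0 supE.
  exact: Edown ca Ea.
have two : {ae mu, forall w, `|phi w| = 0 \/ `|phi w| = c}.
  apply: filterS2 above below => w abv blw.
  have Nc : `|phi w| <= c.
    rewrite leNgt; apply/negP => /ltr_add_invr[n] /ltW; exact: abv.
  have [->|N0] := eqVneq `|phi w| 0; [by left|right].
  apply/eqP; rewrite eq_le Nc leNgt; apply/negP => /ltr_add_invr[n Nn].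
  by apply: (blw n); rewrite lt_neqAle eq_sym N0 normr_ge0 lerBrDr ltW.
exists c => //; rewrite lt_neqAle c0 andbT; apply/eqP => c00; apply: phin0.
by apply: filterS two => w; rewrite -c00 => -[] /normr0_eq0.
Qed.

End norm_of_a_hilbert_point.

(** * Translations of the Cantor group and finite coordinate flips *)

Section cantor_translations.
Implicit Types a w : cantor_group.

Lemma cantor_mulK a : involutive (cantor_mul a).
Proof. by move=> w; apply/funext => j; rewrite /cantor_mul addbA addbb. Qed.

Lemma nbhs_coord (w : cantor_space) j : nbhs w [set v : cantor_space | v j = w j].
Proof.
have pc := @proj_continuous nat (fun=> bool) j w.
by apply: (pc [set w j]); exact: discrete_set1.
Qed.

Lemma cantor_mul_continuous a :
  continuous (cantor_mul a : cantor_space -> cantor_space).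
Proof.
(* The product topology is tested one coordinate at a time, and coordinate j of the translate
   depends on [v j] alone. *)
move=> w; apply/cvg_sup => j U [?/= [[W oW <-]]] /= Wj /filterS; apply.
by apply: filterS (nbhs_coord w j) => v /= vj; rewrite /cantor_mul /proj vj.
Qed.

Lemma measurable_cantor_mul a : measurable_fun setT (cantor_mul a).
Proof.
apply: (@measurability _ _ cantor_group cantor_group setT _
  (@open cantor_space)) => //.
move=> _ [V oV <-]; rewrite setTI; apply: sub_sigma_algebra.
by move: oV; apply: open_comp => w _; exact: cantor_mul_continuous.
Qed.

Lemma cantor_mul_image a (A : set cantor_group) :
  cantor_mul a @` A = cantor_mul a @^-1` A.
Proof.
apply/seteqP; split=> [_ [w Aw <-] /=|w Aw]; first by rewrite cantor_mulK.
by exists (cantor_mul a w); rewrite ?cantor_mulK.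
Qed.

Lemma finitely_valued_coord_sign (R : realType) j :
  finitely_valued (coord_sign R j : cantor_group -> R).
Proof.
rewrite /coord_sign.
have fb : finitely_valued (fun w : cantor_group => w j).
  split; first exact: finite_finset.
  move=> b; apply: sub_sigma_algebra; rewrite /= openE => w wb.
  by apply: filterS (nbhs_coord w j) => v vj; exact: etrans vj wb.
(* The constant of type [unit] is a dummy second argument, which makes the binary closure lemma
   apply to a unary function. *)
exact: (@finitely_valued_comp2 _ _ bool unit R (fun b _ => (-1) ^+ b) _ _
  fb (finitely_valued_cst _ tt)).
Qed.

Context (R : realType) (mu : probability cantor_group R).
Hypothesis mu_haar : is_haar mu.

Lemma ae_cantor_mul a (P : set cantor_group) :
  {ae mu, forall w, P w} -> {ae mu, forall w, P (cantor_mul a w)}.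
Proof.
move=> [Z [mZ Z0 PZ]]; exists (cantor_mul a @` Z); split.
- rewrite cantor_mul_image -[X in measurable X]setTI.
  exact: measurable_cantor_mul.
- by rewrite -[RHS]Z0; exact: mu_haar.
- by rewrite cantor_mul_image => w /PZ.
Qed.

(** Counting occurrences modulo 2 makes concatenation of lists correspond to the group law. *)
Definition flips (s : seq nat) : cantor_group := fun j => odd (count_mem j s).

Lemma flips_cat s t w :
  cantor_mul (flips s) (cantor_mul (flips t) w) = cantor_mul (flips (s ++ t)) w.
Proof.
by apply/funext => j; rewrite /cantor_mul /flips count_cat oddD addbA.
Qed.

(** There are countably many finite lists, so the translates of an almost sure event under all
    finite flips have a common point. *)
Lemma ae_flips (P : set cantor_group) : {ae mu, forall w, P w} ->
  exists w, forall s, P (cantor_mul (flips s) w).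
Proof.
move=> aeP.
(* Lists are numbered by their codes; a number that codes no list stands for the empty one. *)
have aeF : {ae mu, forall w, forall n,
    P (cantor_mul (flips (odflt [::] (unpickle n))) w)}.
  by apply: ae_foralln => n; exact: ae_cantor_mul.
have muT : (0 < mu setT)%E by rewrite probability_setT lte01.
have [w Pw] := @filter_ex _ _ (ae_properfilter_algebraOfSetsType muT) _ aeF.
by exists w => s; have := Pw (pickle s); rewrite pickleK.
Qed.

End cantor_translations.

(** * Rademacher sums and the effect of flips *)

Lemma finite_series_cvg (R : realType) (V : normedModType R) (y : nat -> V)
    (t : seq nat) : uniq t -> (forall k, k \notin t -> y k = 0) ->
  series y n @[n --> \oo] --> \sum_(k <- t) y k.
Proof.
(* A partial sum has n terms, with indices below n, so it covers [t] as soon as n exceeds the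
   largest index. *)
move=> ut yt; apply: cvg_near_cst; exists (\max_(k <- t) k).+1 => // n /= tn.
rewrite /series /= (bigID (mem t)) /= [X in _ + X]big1; last exact: yt.
rewrite addr0 -big_filter; apply/perm_big/uniq_perm => //.
  by rewrite filter_uniq// iota_uniq.
move=> k; rewrite mem_filter mem_index_iota /=.
case: (boolP (k \in t)) => //= kt; apply: leq_ltn_trans tn.
by rewrite (big_rem k kt)/= leq_maxl.
Qed.

Section rademacher_sums.
Context (R : realType) (H : completeNormedModType R).
Variable x : nat -> H.
Implicit Types (w : cantor_group) (i j : nat).

Let y w j : H := coord_sign R j w *: x j.

Lemma norm_rademacher_term w j : `|y w j| = `|x j|.
Proof. by rewrite normrZ normr_sign mul1r. Qed.

Lemma rademacher_sum_cvg w : cvgn (rademacher_series x w) ->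
  rademacher_series x w n @[n --> \oo] --> rademacher_sum x w.
Proof. by []. Qed.

Lemma rademacher_term_flip w i j :
  y (cantor_mul (flips [:: i]) w) j = y w j - (if j == i then 2 *: y w i else 0).
Proof.
rewrite /y /coord_sign /cantor_mul /flips/= addn0 oddb eq_sym.
have [->|_] := eqVneq j i; last by rewrite subr0.
rewrite signr_addb expr1 mulN1r scaleNr -[2]/(1 + 1) scalerDl scale1r.
by rewrite opprD addrA subrr add0r.
Qed.

Lemma rademacher_series_flip w i : cvgn (rademacher_series x w) ->
  rademacher_series x (cantor_mul (flips [:: i]) w) n @[n --> \oo] -->
  rademacher_sum x w - 2 *: y w i.
Proof.
move=> cw; rewrite /rademacher_series.
pose z j := if j == i then 2 *: y w i else 0.
have -> : series (fun j => coord_sign R j (cantor_mul (flips [:: i]) w) *: x j) =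
    (fun n => rademacher_series x w n - series z n).
  apply/funext => n; rewrite /rademacher_series /series/= -sumrB.
  by apply: eq_bigr => j _; exact: rademacher_term_flip.
apply: cvgB; first exact: rademacher_sum_cvg.
have := @finite_series_cvg R H z [:: i] isT.
rewrite big_seq1 /z eqxx; apply => k; rewrite inE => /negbTE ->//.
Qed.

Lemma rademacher_sum_flip w i : cvgn (rademacher_series x w) ->
  rademacher_sum x (cantor_mul (flips [:: i]) w) = rademacher_sum x w - 2 *: y w i.
Proof. by move=> cw; apply/cvg_lim => //; exact: rademacher_series_flip. Qed.

Lemma rademacher_sum_flip2 w i j : cvgn (rademacher_series x w) -> i != j ->
  rademacher_sum x (cantor_mul (flips [:: i; j]) w) =
  rademacher_sum x w - 2 *: y w i - 2 *: y w j.
Proof.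
move=> cw ij; rewrite -(flips_cat [:: i] [:: j]) rademacher_sum_flip; last first.
  by apply/cvg_ex; eexists; exact: rademacher_series_flip.
rewrite rademacher_sum_flip// rademacher_term_flip (negbTE ij) subr0.
by rewrite addrAC.
Qed.

(** The partial sums are themselves the approximating simple functions, as each depends on finitely
    many signs. *)
Lemma strongly_measurable_rademacher_sum :
  (forall w, cvgn (rademacher_series x w)) ->
  strongly_measurable (rademacher_sum x).
Proof.
move=> cx; exists (fun n w => rademacher_series x w n); split; last first.
  by move=> w; exact: rademacher_sum_cvg.
elim=> [|n IH].
  rewrite /rademacher_series /series/=; under eq_fun do rewrite big_geq//.
  exact: finitely_valued_cst.
rewrite /rademacher_series /series/=; under eq_fun do rewrite big_nat_recr//=.
apply: (finitely_valued_comp2 (fun u r => u + r *: x n) IH).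
exact: finitely_valued_coord_sign.
Qed.

(** If the sum vanished at a point and at all its flips, the change [2 y j] caused by one flip would
    be 0 for every j. *)
Lemma rademacher_sum_not_ae0 (mu : probability cantor_group R) :
  is_haar mu -> (forall w, cvgn (rademacher_series x w)) -> (exists j, x j <> 0) ->
  ~ {ae mu, forall w, rademacher_sum x w = 0}.
Proof.
move=> haar cx [j xj] /(ae_flips haar)[w w0]; apply: xj; apply/eqP.
have wE : cantor_mul (flips [::]) w = w by apply/funext.
have := w0 [:: j]; rewrite rademacher_sum_flip// -[in X in X - _]wE w0 sub0r.
move/eqP; rewrite oppr_eq0 scaler_eq0 pnatr_eq0/= => /eqP yj.
by rewrite -normr_eq0 -(norm_rademacher_term w) yj normr0.
Qed.

End rademacher_sums.

(** * Rearrangements of finitely supported sequences *)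

Section signed_permutations.
Context (R : realType) (H : completeNormedModType R).
Implicit Types (x y : nat -> H).

(** The support of [x] lies in the image under [s] of the first n indices, so every sign series is
    eventually constant. The sign of [y j] in the limit combines the coordinate [w (s j)] with
    [e j]. *)
Lemma signed_permutation_sum x y n : signed_permutation x y ->
  (forall j, (n <= j)%N -> y j = 0) ->
  (forall w, cvgn (rademacher_series x w)) /\
  forall w, exists b : nat -> bool,
    rademacher_sum x w = \sum_(j < n) (-1) ^+ b j *: y j.
Proof.
move=> [s [e [[g sg gs] yE]]] y0.
have xE k : x k = (-1) ^+ e (g k) *: y (g k).
  by rewrite yE gs scalerA -signr_addb addbb scale1r.
pose t := [seq s j | j <- iota 0 n].
have ut : uniq t by rewrite map_inj_uniq ?iota_uniq//; exact: can_inj sg.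
have xt w k : k \notin t -> coord_sign R k w *: x k = 0.
  move=> kt; rewrite xE y0 ?scaler0// leqNgt; apply: contra kt => gkn.
  by rewrite -(gs k) map_f// mem_iota.
have cx w := finite_series_cvg ut (xt w).
split=> [w|w]; first by apply/cvg_ex; eexists; exact: cx.
exists (fun j => w (s j) (+) e j); rewrite /rademacher_sum (cvg_lim _ (cx w))//.
rewrite /t big_map -[X in iota 0 X]subn0 -/(index_iota 0 n) big_mkord.
apply: eq_bigr => j _.
by rewrite xE sg scalerA -signr_addb.
Qed.

Lemma signed_permutation_neq0 x y j : signed_permutation x y -> y j <> 0 ->
  exists k, x k <> 0.
Proof.
move=> [s [e [_ ->]]] yj; exists (s j) => x0.
by apply: yj; rewrite x0 scaler0.
Qed.

(** This moves a finite support to the first indices, in the order of [t] and with prescribed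
    signs. *)
Lemma signed_permutation_head x (t : seq nat) (e : nat -> bool) : uniq t ->
  (forall k, k \notin t -> x k = 0) ->
  exists y, [/\ signed_permutation x y,
    forall j, (j < size t)%N -> y j = (-1) ^+ e j *: x (nth 0%N t j) &
    forall j, (size t <= j)%N -> y j = 0].
Proof.
move=> ut xt; have [s [bs sE]] := bijective_extension ut.
exists (fun j => (-1) ^+ e j *: x (s j)); split; first by exists s, e.
  by move=> j jt; rewrite sE.
move=> j tj; rewrite xt ?scaler0//; apply/negP => /(nthP 0%N)[k kt].
by rewrite -sE// => /(bij_inj bs) kj; move: kt; rewrite kj ltnNge tj.
Qed.

End signed_permutations.

(** * Classification of the coefficient sequences *)

Section classification.
Context (R : realType) (H : completeNormedModType R) (dot : {dot H for idfun}).
Hypothesis dotE : forall u : H, dot u u = `|u| ^+ 2.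
Context (mu : probability cantor_group R).
Hypothesis mu_haar : is_haar mu.
Variable x : nat -> H.

(** The first clause excludes the zero sequence, whose sum is trivial and thus not a Hilbert
    point. *)
Definition orthogonal_summable :=
  [/\ exists j, x j <> 0, forall i j, i <> j -> dot (x i) (x j) = 0 &
      (\sum_(0 <= j <oo) (`|x j| ^+ 2)%:E < +oo)%E].

Definition two_equal_vectors := exists y : nat -> H, signed_permutation x y /\
  [/\ y 0%N = y 1%N, y 0%N <> 0 & forall j, (2 <= j)%N -> y j = 0].

Definition hexagonal_vectors := exists y : nat -> H, signed_permutation x y /\
  exists u v : H,
    [/\ [/\ u <> 0, v <> 0, `|u| = `|v| & dot u v = 0],
        y 0%N = u,
        y 1%N = 2^-1 *: u + (Num.sqrt 3 / 2) *: v,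
        y 2%N = 2^-1 *: u - (Num.sqrt 3 / 2) *: v &
        forall j, (3 <= j)%N -> y j = 0].

Let y w j : H := coord_sign R j w *: x j.

Let yE w j : y w j = 0 -> x j = 0.
Proof.
move=> y0; apply/normr0_eq0.
by rewrite -(norm_rademacher_term x w) -/(y w j) y0 normr0.
Qed.

Lemma vanishing_rademacher_sum w c : c != 0 -> cvgn (rademacher_series x w) ->
  rademacher_sum x w = 0 -> (exists j, x j <> 0) ->
  (forall s, `|rademacher_sum x (cantor_mul (flips s) w)| = 0 \/
             `|rademacher_sum x (cantor_mul (flips s) w)| = c) ->
  two_equal_vectors \/ hexagonal_vectors.
Proof.
move=> c0 cw w0 [j0 xj0] wc.
have flip1 i : `|2 *: y w i| = 0 \/ `|2 *: y w i| = c.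
  by have := wc [:: i]; rewrite rademacher_sum_flip// w0 sub0r normrN.
have flip2 i j : i != j ->
    `|2 *: y w i + 2 *: y w j| = 0 \/ `|2 *: y w i + 2 *: y w j| = c.
  move=> ij; have := wc [:: i; j].
  by rewrite rademacher_sum_flip2// w0 sub0r -opprD normrN.
have [t [ut tE]] := @enum_bounded_pred (fun i => y w i != 0) 3
  (fun s => vanishing_size dotE flip1 flip2 c0).
have t3 : (size t <= 3)%N.
  apply: (vanishing_size dotE flip1 flip2 c0) => //.
  by apply/allP => i; rewrite tE.
have yt k : k \notin t -> y w k = 0 by rewrite tE negbK => /eqP.
have xt k : k \notin t -> x k = 0 by move=> /yt /yE.
have sum0 : \sum_(k <- t) y w k = 0.
  by apply: etrans w0; apply/esym/cvg_lim => //; exact: finite_series_cvg ut yt.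
have yn k : k \in t -> `|y w k| = c / 2.
  rewrite tE => yk; have := flip1 k; rewrite normrZ ger0_norm//.
  case=> [/eqP|<-]; last by field.
  by rewrite mulf_eq0 pnatr_eq0/= normr_eq0 (negbTE yk).
(* The signs are chosen so that [z] starts with the first nonzero term at [w] and continues with the
   negatives of the others. The vanishing sum then reads [z 0 = z 1] or [z 0 = z 1 + z 2]. *)
have [z [sz zt z0]] := signed_permutation_head
  (fun j => (j != 0%N) (+) w (nth 0%N t j)) ut xt.
have {}zt j : (j < size t)%N ->
    z j = (-1) ^+ (j != 0%N) *: y w (nth 0%N t j).
  by move=> jt; rewrite zt// signr_addb -scalerA.
case: t ut t3 sum0 yn tE yt xt zt z0 => [|i [|j [|k [|? ?]]]]//.
- by move=> _ _ _ _ _ _ /(_ j0 isT).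
- move=> _ _ + _ tE _ _ _ _; rewrite big_seq1 => yi0.
  by have := tE i; rewrite inE eqxx yi0 eqxx.
- move=> ut _ + _ tE _ _ zt z0; rewrite big_cons big_seq1 => /eqP.
  rewrite addr_eq0 => /eqP yij; left; exists z; split=> //.
  have z01 : z 0%N = y w i by rewrite zt//= scale1r.
  split=> //; first by rewrite z01 zt//= expr1 scaleN1r.
  by rewrite z01; apply/eqP; rewrite -tE inE eqxx.
- move=> ut _ + yn tE _ _ zt z0; rewrite !big_cons big_nil addr0 => /eqP.
  rewrite addr_eq0 => /eqP yijk; right; exists z; split=> //.
  have zi : z 0%N = y w i by rewrite zt//= scale1r.
  have zj : z 1%N = - y w j by rewrite zt//= expr1 scaleN1r.
  have zk : z 2%N = - y w k by rewrite zt//= expr1 scaleN1r.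
  have [||||u [v [uv zu z1 z2]]] :=
    @hexagonal_triple _ _ _ dotE (z 0%N) (z 1%N) (z 2%N).
  + by rewrite zi zj zk yijk opprD.
  + by rewrite zi -tE inE eqxx.
  + by rewrite zi zj normrN !yn// !inE eqxx ?orbT.
  + by rewrite zi zk normrN !yn// !inE eqxx ?orbT.
  by exists u, v.
Qed.

Lemma nonvanishing_rademacher_sum w : cvgn (rademacher_series x w) ->
  (exists j, x j <> 0) ->
  (forall s, `|rademacher_sum x (cantor_mul (flips s) w)| =
             `|rademacher_sum x w|) ->
  orthogonal_summable.
Proof.
move=> cw xn0 wc.
have flip1 i : `|rademacher_sum x w - 2 *: y w i| = `|rademacher_sum x w|.
  by rewrite -(wc [:: i]) rademacher_sum_flip.
have flip2 i j : i != j ->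
    `|rademacher_sum x w - 2 *: y w i - 2 *: y w j| = `|rademacher_sum x w|.
  by move=> ij; rewrite -(wc [:: i; j]) rademacher_sum_flip2.
split=> // [i j /eqP ij|].
  have /eqP := equal_norm_orthogonal dotE flip1 flip2 ij.
  by rewrite dotZl dotZr !mulf_eq0 !signr_eq0/= => /eqP.
(* Bessel's inequality bounds all partial sums by the squared norm of the sum at [w]. *)
apply: (@le_lt_trans _ _ (`|rademacher_sum x w| ^+ 2)%:E); last exact: ltry.
apply: lime_le; first by apply: is_cvg_nneseries => j _ _; rewrite lee_fin sqr_ge0.
apply: nearW => n; rewrite sumEFin lee_fin.
rewrite (eq_bigr (fun j => `|y w j| ^+ 2)); first exact: equal_norm_bessel.
by move=> j _; rewrite norm_rademacher_term.
Qed.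

(** In the converse direction the exponent can always be taken infinite. *)
Lemma rademacher_hilbert_point (c : R) : (forall w, cvgn (rademacher_series x w)) ->
  (exists j, x j <> 0) ->
  (forall w, `|rademacher_sum x w| = 0 \/ `|rademacher_sum x w| = c) ->
  exists p : \bar R, [/\ (1 <= p)%E, p <> 2%:E,
    {ae mu, forall w, cvgn (rademacher_series x w)} &
    hilbert_point dot mu p (rademacher_sum x)].
Proof.
move=> cx xn0 xc; exists +oo%E; split=> //; first by rewrite leey.
  exact/aeW.
apply: (two_valued_hilbert_point dotE _ xc).
  exact: strongly_measurable_rademacher_sum.
exact: rademacher_sum_not_ae0.
Qed.

Lemma orthogonal_partial_sum w m n :
  (forall i j, i <> j -> dot (x i) (x j) = 0) ->
  `|\sum_(m <= j < n) y w j| ^+ 2 = \sum_(m <= j < n) `|x j| ^+ 2.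
Proof.
move=> xo; rewrite (norm_sum_orthogonal dotE) ?iota_uniq//; last first.
  by move=> i j /eqP ij; rewrite dotZl dotZr xo// !mulr0.
by apply: eq_bigr => j _; rewrite norm_rademacher_term.
Qed.

(** By Pythagoras, the Cauchy criterion with [e] for the sign series is the one with [e ^ 2] for the
    series of squared norms; it holds at every point w. *)
Lemma orthogonal_rademacher_cvg w : orthogonal_summable ->
  cvgn (rademacher_series x w).
Proof.
move=> [_ xo xs]; apply/cauchy_cvgP/cauchy_seriesP => e e0.
have cs : cvgn (series (fun j => `|x j| ^+ 2)).
  have [M sM] : exists M : R, forall n,
      \sum_(0 <= j < n) `|x j| ^+ 2 <= M.
    have x0 (n : nat) : (0 <= n)%N -> true -> (0 <= (`|x n| ^+ 2)%:E)%E.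
      by move=> _ _; rewrite lee_fin sqr_ge0.
    exists (fine (\sum_(0 <= j <oo) (`|x j| ^+ 2)%:E)%E) => n.
    rewrite -lee_fin fineK; last first.
      by rewrite ge0_fin_numE//; apply: nneseries_ge0.
    by rewrite -sumEFin; exact: nneseries_lim_ge.
  apply: nondecreasing_is_cvgn.
    by apply: nondecreasing_series => n _ _; exact: sqr_ge0.
  by exists M => _ [n _ <-]; exact: sM.
move/cauchy_cvgP/cauchy_seriesP : cs => /(_ (e ^+ 2)).
rewrite exprn_gt0// => /(_ isT); apply: filterS => -[m n] /=.
rewrite -(orthogonal_partial_sum w)// ger0_norm ?sqr_ge0//.
by rewrite ltr_pXn2r// nnegrE// ltW.
Qed.

(** The norms [q n] of the partial sums do not depend on w, so neither does their limit. *)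
Lemma orthogonal_rademacher_norm : orthogonal_summable ->
  exists c : R, forall w, `|rademacher_sum x w| = c.
Proof.
move=> os; have [_ xo _] := os.
pose q n := Num.sqrt (\sum_(0 <= j < n) `|x j| ^+ 2).
exists (limn q) => w; apply/esym/cvg_lim => //.
rewrite (_ : q = fun n => `|rademacher_series x w n|).
  by apply: cvg_norm; apply: rademacher_sum_cvg; exact: orthogonal_rademacher_cvg.
apply/funext => n; rewrite /q -(orthogonal_partial_sum w)//.
by rewrite sqrtr_sqr normr_id.
Qed.

End classification.

(** If the last two signs agree, the [v] component cancels and the [u] coefficient is 0, 2 or -2.
    Otherwise the coefficients are 1 and [sqrt 3] up to sign, and [1 + 3 = 4]. *)
Lemma hexagonal_sign_sum (R : realType) (H : completeNormedModType R)
    (dot : {dot H for idfun}) (dotE : forall u : H, dot u u = `|u| ^+ 2)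
    (u v : H) (a b c : bool) : `|u| = `|v| -> dot u v = 0 ->
  let s := (-1) ^+ a *: u + (-1) ^+ b *: (2^-1 *: u + (Num.sqrt 3 / 2) *: v) +
    (-1) ^+ c *: (2^-1 *: u - (Num.sqrt 3 / 2) *: v) in
  `|s| = 0 \/ `|s| = 2 * `|u|.
Proof.
move=> nuv uv s.
have r3 : (Num.sqrt 3 : R) ^+ 2 = 3 by rewrite sqr_sqrtr ?ler0n.
have sE : s = ((-1) ^+ a + ((-1) ^+ b + (-1) ^+ c) / 2) *: u +
    (Num.sqrt 3 / 2 * ((-1) ^+ b - (-1) ^+ c)) *: v.
  rewrite /s !scalerDr scalerN !scalerA mulrBr scalerBl mulrDl !scalerDl.
  rewrite ![Num.sqrt 3 / 2 * _]mulrC -!addrA; congr (_ + (_ + _)).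
  by rewrite addrCA.
have s2 (z : H) : `|z| ^+ 2 = 0 \/ `|z| ^+ 2 = (2 * `|u|) ^+ 2 ->
    `|z| = 0 \/ `|z| = 2 * `|u|.
  case=> [/eqP|/eqP]; first by rewrite expf_eq0/= => /eqP; left.
  by rewrite eqrXn2// ?mulr_ge0// => /eqP; right.
apply: s2; rewrite sE (normD2_orthogonal dotE)//; last first.
  by rewrite dotZl dotZr uv !mulr0.
rewrite !norm2Z -nuv !exprMn r3 {sE}; move: @s => _.
by case: a; case: b; case: c; rewrite /= ?expr0 ?expr1;
  first [left; by field|right; by field].
Qed.

Theorem theorem2 (R : realType) (H : completeNormedModType R)
    (dot : {dot H for idfun}) (dotE : forall u : H, dot u u = `|u| ^+ 2)
    (mu : probability cantor_group R) (mu_haar : is_haar mu)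
    (x : nat -> H) :
  (exists p : \bar R, [/\ (1 <= p)%E, p <> 2%:E,
      {ae mu, forall w, cvgn (rademacher_series x w)} &
      hilbert_point dot mu p (rademacher_sum x)])
  <->
  [\/ [/\ exists j, x j <> 0,
          forall i j, i <> j -> dot (x i) (x j) = 0 &
          (\sum_(0 <= j <oo) (`|x j| ^+ 2)%:E < +oo)%E],
      exists y : nat -> H, signed_permutation x y /\
        [/\ y 0%N = y 1%N, y 0%N <> 0 & forall j, (2 <= j)%N -> y j = 0] |
      exists y : nat -> H, signed_permutation x y /\
        exists u v : H,
          [/\ [/\ u <> 0, v <> 0, `|u| = `|v| & dot u v = 0],
              y 0%N = u,
              y 1%N = 2^-1 *: u + (Num.sqrt 3 / 2) *: v,
              y 2%N = 2^-1 *: u - (Num.sqrt 3 / 2) *: v &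
              forall j, (3 <= j)%N -> y j = 0]].
Proof.
split=> [[p [p1 p2 cx phiH]]|[os|[y [xy [y01 y0 y2]]]|]].
- have xn0 : exists j, x j <> 0.
    apply: contrapT => /forallNP x0; case: phiH => _ + _; apply; apply/aeW => w.
    rewrite /rademacher_sum (_ : rademacher_series x w = fun=> 0) ?lim_cst//.
    apply/funext => n; rewrite /rademacher_series /series/= big1// => j _.
    by rewrite (contrapT (x0 j)) scaler0.
  have [c c0 xc] := hilbert_point_norm_two_valued dotE p1 p2 phiH.
  (* One base point is fixed at which convergence and the two-valued norm hold along the whole orbit
     of finite flips. *)
  have [w good] := ae_flips mu_haar (filterI cx xc).
  have goodS s t : let v := cantor_mul (flips s) (cantor_mul (flips t) w) in
      cvgn (rademacher_series x v) /\
      (`|rademacher_sum x v| = 0 \/ `|rademacher_sum x v| = c).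
    by rewrite /= flips_cat; exact: good.
  (* A zero on the orbit leads to two equal vectors or to the hexagonal triple; without a zero the
     norm is c on the whole orbit and the vectors are orthogonal. *)
  have [[t wt]|/forallNP wn0] :=
      pselect (exists t, rademacher_sum x (cantor_mul (flips t) w) = 0).
    have [ct _] := good t.
    have wc s := (goodS s t).2.
    by case: (vanishing_rademacher_sum dotE (lt0r_neq0 c0) ct wt xn0 wc);
      [constructor 2|constructor 3].
  constructor 1; apply: (nonvanishing_rademacher_sum dotE
    (w := cantor_mul (flips [::]) w)) => //.
    by have [] := good [::].
  have wc s : `|rademacher_sum x (cantor_mul (flips s) w)| = c.
    by have [_ [/normr0_eq0 /wn0|]] := good s.
  by move=> s; rewrite flips_cat !wc.
- have [c xc] := orthogonal_rademacher_norm dotE os; have [xn0 _ _] := os.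
  apply: (@rademacher_hilbert_point _ _ _ dotE mu mu_haar x c) => // w.
    exact: (orthogonal_rademacher_cvg dotE).
  by right.
- have [cx xE] := signed_permutation_sum xy y2.
  apply: (@rademacher_hilbert_point _ _ _ dotE mu mu_haar x `|2 *: y 0%N|) => //.
    exact: signed_permutation_neq0 xy y0.
  move=> w; have [b ->] := xE w.
  (* As [y 0 = y 1], the sum is [2 y 0] up to sign when the two signs agree and 0 when they
     differ. *)
  rewrite !big_ord_recl big_ord0 addr0 /= -y01 -scalerDl.
  case: (b 0%N); case: (b 1%N); rewrite /= ?expr0 ?expr1.
  + by right; rewrite -opprD scaleNr normrN.
  + by left; rewrite addNr scale0r normr0.
  + by left; rewrite addrN scale0r normr0.
  + by right.
- move=> [y [xy [u [v [[u0 v0 nuv uv] y0 y1 y2 y3]]]]].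
  have [cx xE] := signed_permutation_sum xy y3.
  apply: (@rademacher_hilbert_point _ _ _ dotE mu mu_haar x (2 * `|u|)) => //.
    by apply: (signed_permutation_neq0 (j := 0%N) xy); rewrite y0.
  move=> w; have [b ->] := xE w.
  rewrite !big_ord_recl big_ord0 addr0 /= y0 y1 y2 addrA.
  exact: hexagonal_sign_sum.
Qed.
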